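(* Let $N_r\ge 1$, let $\mathcal{S}$ be a nonempty finite index set (the selected users), and let $P>0$. Let $\mathbf{h}_s,\bar{\mathbf{h}}_s\in\mathbb{C}^{N_r}\setminus\{0\}$, $s\in\mathcal{S}$, be two families of vectors such that, for every $s\in\mathcal{S}$, $$\frac{\bar{\mathbf{h}}_s}{\|\bar{\mathbf{h}}_s\|}=\frac{\mathbf{h}_s}{\|\mathbf{h}_s\|}\qquad\text{and}\qquad \|\bar{\mathbf{h}}_s\|\ge\|\mathbf{h}_s\|.$$ Let $$\mathrm{obj}^*=\max_{\|\mathbf{m}\|=1}\ \min_{s\in\mathcal{S}} P\,|\mathbf{m}^{\mathsf{H}}\mathbf{h}_s|^2,\qquad \overline{\mathrm{obj}}^*=\max_{\|\mathbf{m}\|=1}\ \min_{s\in\mathcal{S}} P\,|\mathbf{m}^{\mathsf{H}}\bar{\mathbf{h}}_s|^2,$$ where both maxima are over $\mathbf{m}\in\mathbb{C}^{N_r}$. Then $\overline{\mathrm{obj}}^*\ge\mathrm{obj}^*$.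
   Context: $(\cdot)^{\mathsf{H}}$ denotes conjugate transpose and $\|\cdot\|$ the Euclidean norm on $\mathbb{C}^{N_r}$. The vectors $\mathbf{h}_s$ and $\bar{\mathbf{h}}_s$ are channel vectors, $\mathbf{m}$ is the receive beam steering vector, and $P$ is the maximum transmit power. *)

(* Defs.v *)
From HB Require Import structures.
From mathcomp Require Import all_boot all_order all_algebra.
From mathcomp Require Import complex.
From mathcomp Require Import all_classical all_reals all_analysis.

Set Implicit Arguments.
Unset Strict Implicit.
Unset Printing Implicit Defensive.

Import Order.TTheory GRing.Theory Num.Theory.
Import numFieldNormedType.Exports.
Import ComplexField.Normc.

Local Open Scope classical_set_scope.
Local Open Scope ring_scope.
Local Open Scope sesquilinear_scope.
Local Open Scope complex_scope.

(* [maximum A] and [minimum A] take the junk value 0 when A has no greatest,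
   respectively least, element; [min_gain_minP] and [max_min_gain_maxP] below
   show that this never happens in [min_gain] and [max_min_gain]. *)
Definition maximum (R : realType) (A : set R) : R :=
  xget 0 (A `&` ubound A).

Definition minimum (R : realType) (A : set R) : R :=
  xget 0 (A `&` lbound A).

(* The norm `|v| that the library puts on matrices is the sup norm, hence the
   explicit Euclidean norm. The modulus normc takes its values in R, whereas
   `|z| lives in R[i]. *)
Definition enorm (R : realType) (n : nat) (v : 'cV[R[i]]_n) : R :=
  Num.sqrt (\sum_(i < n) normc (v i 0) ^+ 2).

Definition gain (R : realType) (n : nat) (P : R) (m h : 'cV[R[i]]_n) : R :=
  P * normc ((m ^t* *m h) 0 0) ^+ 2.

Definition min_gain (R : realType) (n : nat) (S : finType) (P : R)
    (h : S -> 'cV[R[i]]_n) (m : 'cV[R[i]]_n) : R :=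
  minimum [set gain P m (h s) | s in [set: S]].

Definition max_min_gain (R : realType) (n : nat) (S : finType) (P : R)
    (h : S -> 'cV[R[i]]_n) : R :=
  maximum [set min_gain P h m | m in [set m : 'cV[R[i]]_n | enorm m = 1]].

Lemma maximumE (R : realType) (A : set R) (x : R) :
  A x -> ubound A x -> maximum A = x.
Proof.
move=> Ax ux; apply: xget_unique => // y [Ay uy].
by apply/le_anti; rewrite (ux _ Ay) (uy _ Ax).
Qed.

Lemma minimumE (R : realType) (A : set R) (x : R) :
  A x -> lbound A x -> minimum A = x.
Proof.
move=> Ax lx; apply: xget_unique => // y [Ay ly].
by apply/le_anti; rewrite (lx _ Ay) (ly _ Ax).
Qed.

Lemma min_gain_bigmin (R : realType) (n : nat) (S : finType) (s0 : S) (P : R)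
    (h : S -> 'cV[R[i]]_n) (m : 'cV[R[i]]_n) :
  min_gain P h m = \big[Order.min/gain P m (h s0)]_s gain P m (h s).
Proof.
apply: minimumE.
  elim/big_ind: _ => [|x y Ax Ay|s _]; [by exists s0| |by exists s].
  by rewrite /Order.min; case: ifP.
by move=> _ [s _ <-]; exact: bigmin_le_cond.
Qed.

Lemma min_gain_minP (R : realType) (n : nat) (S : finType) (P : R)
    (h : S -> 'cV[R[i]]_n) (m : 'cV[R[i]]_n) :
  (0 < #|S|)%N ->
  (exists s, min_gain P h m = gain P m (h s)) /\
  (forall s, min_gain P h m <= gain P m (h s)).
Proof.
move=> /card_gt0P[s0 _]; split=> [|s]; rewrite (min_gain_bigmin s0).
  elim/big_ind: _ => [|x y [s ->] [t ->]|s _]; [by exists s0| |by exists s].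
  by rewrite /Order.min; case: ifP => _; [exists s|exists t].
exact: bigmin_le_cond.
Qed.

Lemma sqr_normcE (R : realType) (z : R[i]) :
  normc z ^+ 2 = complex.Re z ^+ 2 + complex.Im z ^+ 2.
Proof. by case: z => a b /=; rewrite sqr_sqrtr ?addr_ge0 ?sqr_ge0. Qed.

Lemma max_min_gain_maxP (R : realType) (n : nat) (S : finType) (P : R)
    (h : S -> 'cV[R[i]]_n) :
  (1 <= n)%N -> (0 < #|S|)%N ->
  (exists2 m, enorm m = 1 & max_min_gain P h = min_gain P h m) /\
  (forall m, enorm m = 1 -> min_gain P h m <= max_min_gain P h).
Proof.
move=> n0 /card_gt0P[s0 _].
suff [m0 m01 m0max] : exists2 m0, enorm m0 = 1 &
    forall m, enorm m = 1 -> min_gain P h m <= min_gain P h m0.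
  have -> : max_min_gain P h = min_gain P h m0.
    by apply: maximumE; [exists m0|move=> _ [m /= m1 <-]; exact: m0max].
  by split => //; exists m0.
pose phi (x : 'rV[R]_(n + n)) : 'cV[R[i]]_n :=
  \col_i (x 0 (lshift n i) +i* x 0 (rshift n i)).
pose psi (m : 'cV[R[i]]_n) : 'rV[R]_(n + n) :=
  row_mx (\row_i complex.Re (m i 0)) (\row_i complex.Im (m i 0)).
have phiK m : phi (psi m) = m.
  by apply/colP => i; rewrite mxE row_mxEl row_mxEr !mxE; case: (m i 0).
pose q (x : 'rV[R]_(n + n)) : R := \sum_j x 0 j ^+ 2.
have enormE x : enorm (phi x) = Num.sqrt (q x).
  rewrite /enorm /q big_split_ord /= -big_split /=; congr Num.sqrt.
  by apply: eq_bigr => i _; rewrite sqr_normcE !mxE.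
have enorm1 x : (enorm (phi x) = 1) <-> q x = 1.
  rewrite enormE; split=> [e|->]; last by rewrite sqrtr1.
  by rewrite -[q x]sqr_sqrtr ?e ?expr1n// sumr_ge0// => j _; rewrite sqr_ge0.
have sumc (U : topologicalType) (I : finType) (F : I -> U -> R) :
    (forall i, continuous (F i)) -> continuous (fun x => \sum_i F i x).
  move=> Fc; apply: continuous_big => // -[x y].
  by apply: cvgD; [exact: cvg_fst|exact: cvg_snd].
have coordc j : continuous (fun x : 'rV[R]_(n + n) => x 0 j : R).
  exact: coord_continuous.
have sqrc (F : 'rV[R]_(n + n) -> R) : continuous F ->
    continuous (fun x => F x ^+ 2).
  by move=> Fc x; apply: (cvgM (Fc x) (Fc x)).
have qc : continuous q by apply: sumc => j; exact: sqrc.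
have gainc s : continuous (fun x => gain P (phi x) (h s)).
  have linc (a b : 'I_n -> R) : continuous (fun x : 'rV[R]_(n + n) =>
      \sum_i (x 0 (lshift n i) * a i + x 0 (rshift n i) * b i)).
    apply: sumc => i y.
    exact: (cvgD (cvgMr_tmp (coordc (lshift n i) y))
                 (cvgMr_tmp (coordc (rshift n i) y))).
  have E x : gain P (phi x) (h s) =
      P * ((\sum_i (x 0 (lshift n i) * complex.Re (h s i 0)
                    + x 0 (rshift n i) * complex.Im (h s i 0))) ^+ 2
         + (\sum_i (x 0 (lshift n i) * complex.Im (h s i 0)
                    + x 0 (rshift n i) * (- complex.Re (h s i 0)))) ^+ 2).
    rewrite /gain sqr_normcE !mxE !raddf_sum /=; congr (_ * (_ ^+ 2 + _ ^+ 2));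
      apply: eq_bigr => i _; rewrite !mxE; case: (h s i 0) => a b /=.
      by rewrite mulNr opprK.
    by rewrite mulNr mulrN.
  rewrite (funext E) => x.
  exact: (cvgMl_tmp (cvgD (sqrc _ (linc _ _) x) (sqrc _ (linc _ _) x))).
pose K := [set x : 'rV[R]_(n + n) | q x = 1].
have Kc : compact K.
  apply: bounded_closed_compact; last first.
    by apply: (@preimage_closed _ _ q [set x | x = 1]) => [x _|];
      [exact: qc|exact: closed_eq].
  exists 1; split=> // M M1 x /= qx1; apply: le_trans (ltW M1).
  rewrite [leLHS]/Num.norm /= mx_normrE; apply/bigmax_leP; split=> // -[i j] _ /=.
  rewrite ord1 -(@ler_pXn2r _ 2) ?nnegrE// expr1n real_normK ?num_real// -qx1.
  by rewrite /q (bigD1 j)//= lerDl sumr_ge0// => k _; rewrite sqr_ge0.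
have K0 : K !=set0.
  exists (delta_mx 0 (lshift n (Ordinal n0))); rewrite /K /= /q.
  rewrite (bigD1 (lshift n (Ordinal n0)))//= big1 ?mxE ?eqxx ?expr1n ?addr0//.
  by move=> j /negPf jn; rewrite mxE jn andbF expr0n.
have fc : continuous (fun x => min_gain P h (phi x)).
  have -> : (fun x => min_gain P h (phi x)) =
      \big[(fun f g : 'rV[R]_(n + n) -> R => f \min g)/
         (fun x => gain P (phi x) (h s0))]_s (fun x => gain P (phi x) (h s)).
    apply/funext => x; rewrite (min_gain_bigmin s0).
    by elim/big_rec2: _ => // s y f _ ->.
  apply: (big_ind (fun f : 'rV[R]_(n + n) -> R => continuous f)) => //.
  by move=> f g fc gc x; apply: continuous_min; [exact: fc|exact: gc].
have [c cK cmax] := EVT_max_rV K0 Kc (continuous_subspaceT fc).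
exists (phi c); first by apply/enorm1; rewrite inE in cK.
move=> m m1; rewrite -(phiK m); apply: cmax; rewrite inE /K /=.
by apply/enorm1; rewrite phiK.
Qed.

(* Main.v *)
(* Scaling a channel by c >= 1 multiplies every gain by c ^+ 2, hence raises the
   worst-case gain of each beam, in particular of the optimal one for [h]. *)

Require Import Defs.
From mathcomp Require Import all_boot all_order all_algebra.
From mathcomp Require Import complex.
From mathcomp Require Import all_classical all_reals all_analysis.

Import Order.TTheory GRing.Theory Num.Theory.
Local Open Scope ring_scope.
Local Open Scope complex_scope.

(** Equal directions make each [hbar s] the multiple of [h s] by the real factor
    [enorm (hbar s) / enorm (h s)], which is at least 1. Gains are quadratic in the channel, so
    [le_gain_collinear] shows that no gain drops, whatever the beam; [le_max_min_gain] carries this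
    through the minimum and the maximum. *)

Lemma enorm_gt0 (R : realType) (n : nat) (v : 'cV[R[i]]_n) :
  v != 0 -> 0 < enorm v.
Proof.
apply: contraNT; rewrite -leNgt /enorm => v0.
have sq0 i : 0 <= ComplexField.Normc.normc (v i 0) ^+ 2 by exact: sqr_ge0.
have : \sum_(i < n) ComplexField.Normc.normc (v i 0) ^+ 2 == 0.
  by rewrite eq_le sumr_ge0// andbT -sqrtr_eq0 eq_le v0 sqrtr_ge0.
rewrite psumr_eq0// => /allP v0'; apply/eqP/colP => i; rewrite mxE.
have := v0' i (mem_index_enum i); rewrite /= sqrf_eq0 => /eqP.
exact: ComplexField.Normc.eq0_normc.
Qed.

Lemma gainZ (R : realType) (n : nat) (P c : R) (m v : 'cV[R[i]]_n) :
  gain P m (c%:C *: v) = c ^+ 2 * gain P m v.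
Proof.
(* The squared modulus of [c%:C] unfolds to [c ^+ 2 + 0 ^+ 2], so no sign condition on [c]
   arises. *)
rewrite /gain -scalemxAr mxE ComplexField.Normc.normcM exprMn (sqr_normcE c%:C) /=.
by rewrite expr0n /= addr0 mulrCA.
Qed.

Lemma gain_ge0 (R : realType) (n : nat) (P : R) (m v : 'cV[R[i]]_n) :
  0 <= P -> 0 <= gain P m v.
Proof. by move=> P0; rewrite mulr_ge0// sqr_ge0. Qed.

Lemma le_gain_collinear (R : realType) (n : nat) (P : R)
    (m v w : 'cV[R[i]]_n) :
  0 <= P -> v != 0 ->
  ((enorm w)^-1)%:C *: w = ((enorm v)^-1)%:C *: v ->
  enorm v <= enorm w ->
  gain P m v <= gain P m w.
Proof.
move=> P0 /enorm_gt0 v0 dir vw.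
have w0 : 0 < enorm w by exact: lt_le_trans vw.
(* Both normalized vectors have the same gain, so the gains of [v] and [w] are in the ratio of the
   squared norms. *)
have := congr1 (gain P m) dir; rewrite !gainZ => E.
have -> : gain P m v = (enorm v / enorm w) ^+ 2 * gain P m w.
  by rewrite exprMn -mulrA E mulrA -exprMn divff ?gt_eqF// expr1n mul1r.
rewrite ler_piMl ?gain_ge0// expr_le1 ?divr_ge0 ?(ltW v0) ?(ltW w0)//.
by rewrite ler_pdivrMr// mul1r.
Qed.

Lemma le_max_min_gain (R : realType) (n : nat) (S : finType) (P : R)
    (h k : S -> 'cV[R[i]]_n) :
  (1 <= n)%N -> (0 < #|S|)%N ->
  (forall m s, gain P m (h s) <= gain P m (k s)) ->
  max_min_gain P h <= max_min_gain P k.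
Proof.
move=> n0 S0 hk.
(* A beam [m] optimal for [h] is feasible for [k], so comparing worst gains at [m] suffices. *)
have [[m m1 ->] _] := max_min_gain_maxP P h n0 S0.
have [_ /(_ m m1)] := max_min_gain_maxP P k n0 S0; apply: le_trans.
(* The index [s] is chosen worst for [k]; the minimum for [h] is at most its gain at this same
   [s]. *)
have [[s ->] _] := min_gain_minP P k m S0.
have [_ /(_ s) hs] := min_gain_minP P h m S0.
exact: le_trans hs (hk m s).
Qed.

Theorem theorem5p2 (R : realType) (Nr : nat) (hNr : (1 <= Nr)%N)
    (S : finType) (hS : (0 < #|S|)%N) (P : R) (hP : 0 < P)
    (h hbar : S -> 'cV[R[i]]_Nr)
    (h_neq0 : forall s, h s != 0) (hbar_neq0 : forall s, hbar s != 0)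
    (hdir : forall s, ((enorm (hbar s))^-1)%:C *: hbar s
                      = ((enorm (h s))^-1)%:C *: h s)
    (hnorm : forall s, enorm (h s) <= enorm (hbar s)) :
  max_min_gain P h <= max_min_gain P hbar.
Proof.
apply: le_max_min_gain => // m s.
by apply: le_gain_collinear; rewrite ?(ltW hP).
Qed.
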